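(* Let $S\subseteq\mathbb{R}^n$ be compact and Zariski dense, and let $\Phi\colon\mathbb{R}[X_1,\ldots,X_n]\to\mathbb{R}[X_1,\ldots,X_n]$ be an $S$-nonnegativity preserver. Then $\Phi$ can be approximated by a sequence of operators from $\mathcal{W}$ with respect to the strong operator topology, i.e. there is a sequence $(\Phi_k)_{k\in\mathbb{N}}$ in $\mathcal{W}$ such that $\|\Phi_k(p)-\Phi(p)\|_\infty\to 0$ as $k\to\infty$ for every $p\in\mathbb{R}[X_1,\ldots,X_n]$.
   Context: A linear map $\Phi$ on $\mathbb{R}[X_1,\ldots,X_n]$ is an $S$-nonnegativity preserver if $p\ge0$ on $S$ implies $\Phi(p)\ge 0$ on $S$ for all polynomials $p$. $S$ is Zariski dense if it is not contained in the zero set of a nonzero polynomial. $\|p\|_\infty:=\max_{x\in S}|p(x)|$. $\mathcal{W}$ denotes the set of all operators on $\mathbb{R}[X_1,\ldots,X_n]$ of the form $p\mapsto\sum_{i=1}^r p(x_i)\cdot f_i$ with $r\in\mathbb{N}$, $x_1,\ldots,x_r\in S$ and polynomials $f_1,\ldots,f_r\in\mathbb{R}[X_1,\ldots,X_n]$ which are nonnegative on $S$. *)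

(* Defs.v *)
From HB Require Import structures.
From mathcomp Require Import all_boot all_order all_algebra.
From mathcomp Require Import all_classical all_reals all_analysis.
From mathcomp Require mpoly.
(* The notations of mpoly clash with those of mathcomp-analysis, so
   R[X_1, ..., X_n] is written [mpoly n R] and evaluation [meval]. *)
Export -(notations) mpoly.

Set Implicit Arguments.
Unset Strict Implicit.
Unset Printing Implicit Defensive.

Import Order.TTheory GRing.Theory Num.Theory.
Import numFieldNormedType.Exports.

Local Open Scope classical_set_scope.
Local Open Scope ring_scope.

Section Defs.
Variables (R : realType) (n : nat).
Implicit Types (p : mpoly n R) (S : set 'rV[R]_n) (x : 'rV[R]_n).

Definition peval p x : R := meval (x ord0) p.

Definition nonneg_on S p : Prop := forall x, S x -> 0 <= peval p x.

Definition nonneg_preserver S (Phi : {linear mpoly n R -> mpoly n R}) : Prop :=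
  forall p, nonneg_on S p -> nonneg_on S (Phi p).

Definition zariski_dense S : Prop :=
  ~ exists2 q : mpoly n R, q != 0 & S `<=` [set x | peval q x = 0].

(* For S compact and nonempty this supremum is the maximum of |p| on S. *)
Definition supnorm S p : R := sup [set `|peval p x| | x in S].

Definition W S : set {linear mpoly n R -> mpoly n R} :=
  [set Psi | exists (r : nat) (x : 'I_r -> 'rV[R]_n) (f : 'I_r -> mpoly n R),
     [/\ forall i, S (x i),
         forall i, nonneg_on S (f i)
       & forall p, Psi p = \sum_(i < r) peval p (x i) *: f i]].

End Defs.

(* Main.v *)
(** Positivity gives |Phi q| <= c |Phi 1| on S whenever |q| <= c on S, so it
    suffices to find operators T_k in W with T_k p -> p uniformly on S and to
    take Phi_k = Phi o T_k, which lies in W again.  For T_k use Bernstein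
    operators on a box containing S, p |-> sum_v p(s_v) B_v, where the node y_v
    of the weight B_v is replaced by an almost nearest point s_v of S: for x in
    S, |s_v - x| is at most about 2 |y_v - x|, so the error is controlled by
    the variance of the weights and a Lipschitz constant of p. *)
Require Import Defs.
From HB Require Import structures.
From mathcomp Require Import all_boot all_order all_algebra.
From mathcomp Require Import all_classical all_reals all_analysis.
From mathcomp Require Import ring lra.

Set Implicit Arguments.
Unset Strict Implicit.
Unset Printing Implicit Defensive.

Import Order.TTheory GRing.Theory Num.Theory.
Import numFieldNormedType.Exports.

Local Open Scope classical_set_scope.
Local Open Scope ring_scope.

(** * Moments of Bernstein weights on bit vectors *)

Section BernoulliWeights.
Variables (R : comNzRingType) (I : finType) (u : I -> R).

(* Bernstein weights are indexed by bit vectors rather than by the number of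
   ones, so that they stay products of independent factors. *)
Definition bernoulli_weight (v : {ffun I -> bool}) : R :=
  \prod_i (if v i then u i else 1 - u i).

(** Independence of the bits: expanding the product of two-term sums by distributivity yields one
    term per bit vector. *)
Lemma bernoulli_weight_prod (g : I -> bool -> R) :
  \sum_v bernoulli_weight v * \prod_i g i (v i) =
  \prod_i (u i * g i true + (1 - u i) * g i false).
Proof.
pose F i (b : bool) := (if b then u i else 1 - u i) * g i b.
rewrite [RHS](eq_bigr (fun i => \sum_b F i b)); last first.
  by move=> i _; rewrite big_bool.
rewrite bigA_distr_bigA; apply: eq_bigr => v _.
by rewrite /bernoulli_weight -big_split.
Qed.

Lemma bernoulli_weight_sum : \sum_v bernoulli_weight v = 1.
Proof.
have := bernoulli_weight_prod (fun _ _ => 1).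
rewrite (eq_bigr bernoulli_weight); last by move=> v _; rewrite big1 ?mulr1.
by move=> ->; rewrite big1 // => i _; ring.
Qed.

(** The product rule applies with factor 1 at every index other than [i] and [j]; for distinct
    indices the factor at [i] is a centred bit, whose mean vanishes. *)
Lemma bernoulli_weight_cov i j :
  \sum_v bernoulli_weight v * (((v i)%:R - u i) * ((v j)%:R - u j)) =
  if i == j then u i * (1 - u i) else 0.
Proof.
pose g k (b : bool) := (if k == i then b%:R - u k else 1) *
                       (if k == j then b%:R - u k else 1).
rewrite (eq_bigr (fun v : {ffun I -> bool} =>
  bernoulli_weight v * \prod_k g k (v k))); last first.
  move=> v _; rewrite /g big_split /= -!big_mkcond /=.
  by rewrite !big_pred1_eq.
rewrite bernoulli_weight_prod (bigD1 i) //= /g eqxx /=.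
case: eqVneq => [<-|nij]; last by rewrite !mulr1; ring.
rewrite big1 ?mulr1; first by ring.
by move=> k /negPf ->; ring.
Qed.

End BernoulliWeights.

Lemma bernoulli_weight_ge0 (R : numDomainType) (I : finType) (u : I -> R)
    (v : {ffun I -> bool}) :
  (forall i, 0 <= u i <= 1) -> 0 <= bernoulli_weight u v.
Proof.
move=> u01; apply: prodr_ge0 => i _; have /andP[u0 u1] := u01 i.
by case: (v i); rewrite ?subr_ge0.
Qed.

Lemma rmorph_bernoulli_weight (R R' : comNzRingType) (h : {rmorphism R -> R'})
    (I : finType) (u : I -> R) (v : {ffun I -> bool}) :
  h (bernoulli_weight u v) = bernoulli_weight (h \o u) v.
Proof.
rewrite rmorph_prod; apply: eq_bigr => i _.
by case: (v i); rewrite /= ?rmorphB ?rmorph1.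
Qed.

(** * Variance of the mean of the bits in one coordinate *)

Section BitMean.
Variables (R : realFieldType) (n m : nat).
Implicit Types (v : {ffun 'I_n * 'I_m.+1 -> bool}) (u : 'I_n -> R).

Definition bit_mean v (j : 'I_n) : R := m.+1%:R^-1 * \sum_k (v (j, k))%:R.

(** Expanding the square gives a double sum of covariances, of which only the [m.+1] diagonal terms
    survive. *)
Lemma bit_mean_variance u j :
  \sum_v bernoulli_weight (u \o fst) v * (bit_mean v j - u j) ^+ 2 =
  u j * (1 - u j) / m.+1%:R.
Proof.
have m0 : m.+1%:R != 0 :> R by rewrite pnatr_eq0.
pose c v k : R := (v (j, k))%:R - u j.
have meanE v : bit_mean v j - u j = m.+1%:R^-1 * \sum_k c v k.
  rewrite /bit_mean sumrB sumr_const card_ord mulrBr -(mulr_natl (u j)).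
  by rewrite (mulKf m0).
pose w := bernoulli_weight (u \o @fst 'I_n 'I_m.+1).
transitivity (m.+1%:R^-1 ^+ 2 * \sum_k \sum_l \sum_v w v * (c v k * c v l)).
  rewrite mulr_sumr; under [RHS]eq_bigr do rewrite mulr_sumr.
  under [RHS]eq_bigr do under eq_bigr do rewrite mulr_sumr.
  under [RHS]eq_bigr do rewrite exchange_big.
  rewrite exchange_big /=; apply: eq_bigr => v _.
  rewrite meanE exprMn mulrCA [X in _ * (_ * X)]expr2 mulr_suml.
  rewrite !mulr_sumr; apply: eq_bigr => k _.
  by rewrite !mulr_sumr.
have covE k l : \sum_v w v * (c v k * c v l) =
    if l == k then u j * (1 - u j) else 0.
  have := bernoulli_weight_cov (u \o @fst 'I_n 'I_m.+1) (j, k) (j, l).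
  by rewrite xpair_eqE eqxx /= eq_sym.
under eq_bigr do under eq_bigr do rewrite covE.
under eq_bigr do rewrite -big_mkcond /= big_pred1_eq.
by rewrite sumr_const card_ord -(mulr_natr (_ * _)); field.
Qed.

End BitMean.

(** * Polynomials are Lipschitz on bounded sets *)

Section Lipschitz.
Variables (R : realType) (n : nat).
Implicit Types (p q : mpoly n R) (S : set 'rV[R]_n) (x y : 'rV[R]_n).

(** The l1 distance splits over coordinates, so that the error can be estimated one coordinate at a
    time. *)
Definition l1dist x y : R := \sum_j `|x ord0 j - y ord0 j|.

Lemma l1dist_ge0 x y : 0 <= l1dist x y.
Proof. exact: sumr_ge0. Qed.

Lemma l1distC x y : l1dist x y = l1dist y x.
Proof. by apply: eq_bigr => j _; rewrite distrC. Qed.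

Lemma l1dist_triangle x y z : l1dist x z <= l1dist x y + l1dist y z.
Proof.
rewrite /l1dist -big_split /=; apply: ler_sum => j _.
exact: ler_distD.
Qed.

Definition lipschitz_on S p (L : R) : Prop :=
  forall x y, S x -> S y -> `|peval p x - peval p y| <= L * l1dist x y.

Lemma pevalD p q x : peval (p + q) x = peval p x + peval q x.
Proof. exact: mevalD. Qed.
Lemma pevalB p q x : peval (p - q) x = peval p x - peval q x.
Proof. exact: mevalB. Qed.
Lemma pevalM p q x : peval (p * q) x = peval p x * peval q x.
Proof. exact: mevalM. Qed.
Lemma pevalZ c p x : peval (c *: p) x = c * peval p x.
Proof. exact: mevalZ. Qed.
Lemma peval1 x : peval (1 : mpoly n R) x = 1.
Proof. exact: meval1. Qed.
Lemma peval_sum (I : Type) (r : seq I) (P : pred I) (f : I -> mpoly n R) x :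
  peval (\sum_(i <- r | P i) f i) x = \sum_(i <- r | P i) peval (f i) x.
Proof. exact: raddf_sum. Qed.

(** Both properties pass from constants and variables to sums and products. The bound [B] is carried
    along because the Lipschitz constant of a product involves the sizes of its factors. *)
Lemma poly_lipschitz_bounded S (M : R) p :
  (forall x, S x -> forall j, `|x ord0 j| <= M) ->
  exists L B, [/\ 0 <= L, 0 <= B, lipschitz_on S p L
                & forall x, S x -> `|peval p x| <= B].
Proof.
move=> SM; pose P q := exists L B, [/\ 0 <= L, 0 <= B, lipschitz_on S q L
  & forall x, S x -> `|peval q x| <= B]; rewrite -/(P p).
have PD q r : P q -> P r -> P (q + r).
  move=> [L [B [L0 B0 qL qB]]] [L' [B' [L'0 B'0 rL rB]]].
  exists (L + L'), (B + B'); split; try exact: addr_ge0.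
    move=> x y Sx Sy; rewrite !pevalD mulrDl opprD addrACA.
    by rewrite (le_trans (ler_normD _ _)) // lerD ?qL ?rL.
  by move=> x Sx; rewrite pevalD (le_trans (ler_normD _ _)) // lerD ?qB ?rB.
have PM q r : P q -> P r -> P (q * r).
  move=> [L [B [L0 B0 qL qB]]] [L' [B' [L'0 B'0 rL rB]]].
  exists (L * B' + B * L'), (B * B'); split.
  - by rewrite addr_ge0 ?mulr_ge0.
  - exact: mulr_ge0.
  - move=> x y Sx Sy; rewrite !pevalM.
    have -> : peval q x * peval r x - peval q y * peval r y =
      (peval q x - peval q y) * peval r x + peval q y * (peval r x - peval r y).
      by ring.
    rewrite (le_trans (ler_normD _ _)) // !normrM mulrDl lerD //.
      rewrite [leRHS]mulrAC ler_pM //; [exact: qL|exact: rB].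
    rewrite -[leRHS]mulrA ler_pM //; [exact: qB|exact: rL].
  - by move=> x Sx; rewrite pevalM normrM ler_pM ?qB ?rB.
have PC c : P (c *: 1).
  exists 0, `|c|; split=> // x.
    by move=> y _ _; rewrite !pevalZ !peval1 subrr normr0 mul0r.
  by move=> _; rewrite pevalZ peval1 mulr1.
have PX j : P (mpolyX R (mnm1 j)).
  exists 1, (Num.max 0 M); split=> //; first by rewrite le_max lexx.
    move=> x y _ _; rewrite /peval !mevalXU mul1r /l1dist (bigD1 j) //=.
    by rewrite lerDl sumr_ge0.
  by move=> x Sx; rewrite /peval mevalXU le_max SM ?orbT.
have P1 : P 1 by rewrite -[1]scale1r.
have P0 : P 0 by rewrite -(scale0r 1).
rewrite [p]mpolyE; apply: (big_ind P) => // m _.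
rewrite -[mpolyX _ m]mul1r scalerAl; apply: (PM) => //.
rewrite mpolyXE_id; apply: (big_ind P P1 PM) => j _.
by elim: (m j) => [|k IH]; rewrite ?expr0 // exprS; apply: PM.
Qed.

End Lipschitz.

(** * Approximating the identity with nodes in [S] *)

Lemma l1dist_near_minimizer (R : realType) (n : nat) (S : set 'rV[R]_n)
    (y : 'rV[R]_n) (e : R) :
  S !=set0 -> 0 < e ->
  exists s, S s /\ forall x, S x -> l1dist s y <= l1dist x y + e.
Proof.
move=> [s0 Ss0] e0; pose E := [set l1dist x y | x in S].
have lbE : has_lbound E by exists 0 => _ [x _ <-]; exact: l1dist_ge0.
have infE : has_inf E by split=> //; exists (l1dist s0 y), s0.
have [_ [s Ss <-] slt] := inf_adherent e0 infE; exists s; split=> // x Sx.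
by rewrite (le_trans (ltW slt)) // lerD2r; apply: ge_inf => //; exists x.
Qed.

Lemma bit_mean_l1_error (R : realFieldType) (n m : nat) (u : 'I_n -> R)
    (j : 'I_n) (d : R) :
  (forall i, 0 <= u i <= 1) -> 0 < d ->
  \sum_v bernoulli_weight (u \o fst) v * `|@bit_mean R n m v j - u j| <=
  d + (m.+1%:R * d)^-1.
Proof.
move=> u01 d0; set w := bernoulli_weight _.
have w0 v : 0 <= w v by apply: bernoulli_weight_ge0 => -[i k]; exact: u01.
have m0 : 0 < m.+1%:R :> R by rewrite ltr0n.
(* This trades the first absolute moment for the variance, which is at most [m.+1%:R^-1]. *)
have abs_le (t : R) : `|t| <= d + d^-1 * t ^+ 2.
  rewrite -lerBlDl mulrC ler_pdivlMr // -real_normK ?num_real //.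
  by have := sqr_ge0 (`|t| - d); nra.
apply: (@le_trans _ _ (\sum_v w v * (d + d^-1 * (bit_mean R v j - u j) ^+ 2))).
  by apply: ler_sum => v _; rewrite ler_wpM2l.
under eq_bigr do rewrite mulrDr mulrCA.
rewrite big_split /= -mulr_suml bernoulli_weight_sum mul1r lerD2l.
rewrite -mulr_sumr bit_mean_variance invfM mulrC ler_pM2r ?invr_gt0 //.
rewrite ler_pdivrMr // mulVf ?gt_eqF //.
by have /andP[] := u01 j; nra.
Qed.

(** The nodes and weights are chosen before [p], so one operator serves all polynomials; [p] enters
    the error only through its Lipschitz constant. *)
Lemma polynomial_approximate_identity (R : realType) (n : nat)
    (S : set 'rV[R]_n) (M e : R) :
  S !=set0 -> 0 < M -> (forall x, S x -> forall j, `|x ord0 j| <= M) ->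
  0 < e ->
  exists (r : nat) (s : 'I_r -> 'rV[R]_n) (f : 'I_r -> mpoly n R),
    [/\ forall i, S (s i), forall i, nonneg_on S (f i)
      & forall p L, 0 <= L -> lipschitz_on S p L -> forall x, S x ->
        `|peval (\sum_i peval p (s i) *: f i - p) x| <= L * e].
Proof.
move=> S0 M0 SM e0.
(* The [n] coordinates will contribute [4 * M * (d + d)] each, at most [e / 2] in total; [n.+1]
   keeps the denominator nonzero when [n] is 0. *)
pose d : R := e / (16 * M * n.+1%:R).
have n0 : 0 < n.+1%:R :> R by rewrite ltr0n.
have d0 : 0 < d by rewrite divr_gt0 // !mulr_gt0.
pose m := Num.truncn ((d ^+ 2)^-1).
have m0 : 0 < m.+1%:R :> R by rewrite ltr0n.
have md : (m.+1%:R * d)^-1 <= d.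
  rewrite invfM ler_pdivrMr // -expr2 invf_ple ?qualifE /= ?exprn_gt0 //.
  exact/ltW/truncnS_gt.
pose T : finType := {ffun 'I_n * 'I_m.+1 -> bool}.
(* The affine map from [-M, M] onto [0, 1], as a polynomial; [y] below undoes it on the nodes. *)
pose a (j : 'I_n) : mpoly n R := (2 * M)^-1 *: (mpolyX R (mnm1 j) + M *: 1).
pose u (x : 'rV[R]_n) j : R := (2 * M)^-1 * (x ord0 j + M).
have aE x j : peval (a j) x = u x j.
  by rewrite pevalZ pevalD pevalZ peval1 mulr1 /peval mevalXU.
have u01 x : S x -> forall j, 0 <= u x j <= 1.
  move=> Sx j; have := SM x Sx j; rewrite ler_norml => /andP[h1 h2].
  have M20 : 0 < 2 * M by rewrite mulr_gt0.
  by rewrite /u mulr_ge0 ?invr_ge0 /=; [rewrite ler_pdivrMl //|..]; lra.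
pose F (v : T) : mpoly n R := bernoulli_weight (a \o fst) v.
have FE x v : peval (F v) x = bernoulli_weight (u x \o fst) v.
  rewrite [LHS](rmorph_bernoulli_weight (meval (x ord0))).
  by congr bernoulli_weight; apply/funext => -[j k] /=; rewrite -aE.
pose y (v : T) : 'rV[R]_n := \row_j (2 * M * bit_mean R v j - M).
have e20 : 0 < e / 2 by rewrite divr_gt0.
have [s sP] := choice (fun v => l1dist_near_minimizer (y v) S0 e20).
have F0 v : nonneg_on S (F v).
  move=> x Sx; rewrite FE; apply: bernoulli_weight_ge0 => -[j k] /=.
  exact: u01.
exists #|T|, (s \o enum_val), (F \o enum_val); split => [i|i|p L L0 pL x Sx].
- exact: (sP _).1.
- exact: F0.
have sumE : \sum_(i < #|T|) peval p (s (enum_val i)) *: F (enum_val i) =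
    \sum_v peval p (s v) *: F v.
  by rewrite [RHS](reindex _ (onW_bij _ (@enum_val_bij T))).
rewrite /= sumE pevalB peval_sum.
pose w := bernoulli_weight (u x \o @fst 'I_n 'I_m.+1).
have {}FE v : peval (F v) x = w v := FE x v.
have w0 v : 0 <= w v by rewrite -FE F0.
have -> : \sum_v peval (peval p (s v) *: F v) x - peval p x =
    \sum_v w v * (peval p (s v) - peval p x).
  under [RHS]eq_bigr do rewrite mulrBr.
  rewrite sumrB -mulr_suml bernoulli_weight_sum mul1r; congr (_ - _).
  by apply: eq_bigr => v _; rewrite pevalZ FE mulrC.
rewrite (le_trans (ler_norm_sum _ _ _)) //.
(* Passing through [y v], the distance from [s v] to [x] is at most [2 * l1dist x (y v) + e / 2];
   rescaling each coordinate by [2 * M] produces the factor [4 * M]. *)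
apply: (@le_trans _ _
  (\sum_v L * (w v * (e / 2) +
    \sum_j (4 * M) * (w v * `|bit_mean R v j - u x j|)))).
  apply: ler_sum => v _; rewrite normrM ger0_norm //.
  rewrite (_ : _ + _ = w v * (e / 2 + 2 * l1dist x (y v))); last first.
    rewrite mulrDr; congr (_ + _); rewrite /l1dist !mulr_sumr.
    apply: eq_bigr => j _; rewrite /y mxE.
    rewrite (_ : x ord0 j - _ = 2 * M * (u x j - bit_mean R v j)); last first.
      by rewrite /u; field; rewrite gt_eqF.
    by rewrite normrM (gtr0_norm (mulr_gt0 _ M0)) // distrC; ring.
  rewrite mulrCA ler_wpM2l //.
  have [Sv sv] := sP v; rewrite (le_trans (pL _ _ Sv Sx)) // ler_wpM2l //.
  rewrite (le_trans (l1dist_triangle _ (y v) _)) //.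
  by have := sv x Sx; rewrite (l1distC (y v) x); lra.
rewrite -mulr_sumr ler_wpM2l // big_split /= -mulr_suml bernoulli_weight_sum.
rewrite mul1r exchange_big /=.
apply: (@le_trans _ _ (e / 2 + \sum_(j < n) (4 * M) * (d + d))).
  rewrite lerD2l; apply: ler_sum => j _; rewrite -mulr_sumr ler_pM2l ?mulr_gt0 //.
  by rewrite (le_trans (bit_mean_l1_error m j (u01 x Sx) d0)) // lerD2l.
rewrite sumr_const card_ord -(mulr_natl (_ * _)).
have -> : n%:R * (4 * M * (d + d)) = e / 2 * (n%:R / n.+1%:R).
  by rewrite /d; field; rewrite addrC natr1 !gt_eqF.
rewrite [leRHS](splitr e) lerD2l ler_piMr ?(ltW e20) //.
by rewrite ler_pdivrMr // mul1r ler_nat.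
Qed.

(** * Transfer to the preserver and convergence *)

(** Both [c *: 1 - q] and [c *: 1 + q] are nonnegative on [S], hence so are their images under
    [Phi]. *)
Lemma nonneg_preserver_bound (R : realType) (n : nat) (S : set 'rV[R]_n)
    (Phi : {linear mpoly n R -> mpoly n R}) (K c : R) (q : mpoly n R) :
  nonneg_preserver S Phi -> 0 <= c ->
  (forall x, S x -> `|peval (Phi 1) x| <= K) ->
  (forall x, S x -> `|peval q x| <= c) ->
  forall x, S x -> `|peval (Phi q) x| <= c * K.
Proof.
move=> PhiS c0 PhiK qc x Sx.
apply: (@le_trans _ _ (c * peval (Phi 1) x)); last first.
  by rewrite ler_wpM2l // (le_trans (ler_norm _)) ?PhiK.
have : nonneg_on S (c *: 1 - q).
  move=> z Sz; rewrite pevalB pevalZ peval1 mulr1 subr_ge0.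
  by rewrite (le_trans (ler_norm _)) ?qc.
move/PhiS => /(_ x Sx); rewrite linearB linearZ /= pevalB pevalZ subr_ge0 => h1.
have : nonneg_on S (c *: 1 + q).
  move=> z Sz; rewrite pevalD pevalZ peval1 mulr1.
  by have := qc z Sz; rewrite ler_norml; lra.
move/PhiS => /(_ x Sx); rewrite linearD linearZ /= pevalD pevalZ => h2.
by rewrite ler_norml h1 andbT; lra.
Qed.

Lemma supnorm_le (R : realType) (n : nat) (S : set 'rV[R]_n) (p : mpoly n R)
    (c : R) :
  S !=set0 -> (forall x, S x -> `|peval p x| <= c) -> 0 <= supnorm S p <= c.
Proof.
move=> [x Sx] pc; have ub : ubound [set `|peval p x| | x in S] c.
  by move=> _ [z Sz <-]; exact: pc.
apply/andP; split; last by apply: ge_sup => //; exists `|peval p x|, x.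
apply: (@le_trans _ _ `|peval p x|) => //.
by apply: ub_le_sup; [exists c | exists x].
Qed.

Section PointOperator.
Variables (R : realType) (n r : nat).
Variables (s : 'I_r -> 'rV[R]_n) (f : 'I_r -> mpoly n R).

Definition point_operator (p : mpoly n R) : mpoly n R :=
  \sum_i peval p (s i) *: f i.

Lemma point_operator_is_linear : linear point_operator.
Proof.
move=> c p q; rewrite /point_operator scaler_sumr -big_split /=.
by apply: eq_bigr => i _; rewrite pevalD pevalZ scalerDl scalerA.
Qed.

HB.instance Definition _ :=
  GRing.isLinear.Build R (mpoly n R) (mpoly n R) _ point_operator
    point_operator_is_linear.

End PointOperator.

Theorem theorem7p1 (R : realType) (n : nat) (S : set 'rV[R]_n)
  (Phi : {linear mpoly n R -> mpoly n R}) :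
  compact S -> zariski_dense S -> nonneg_preserver S Phi ->
  exists Phi_ : nat -> {linear mpoly n R -> mpoly n R},
    (forall k, W S (Phi_ k)) /\
    (forall p : mpoly n R,
       (fun k => supnorm S (Phi_ k p - Phi p)) @ \oo --> (0 : R)).
Proof.
move=> cS zS PhiS.
(* Zariski density excludes the empty set, which lies in the zero set of the constant 1. *)
have S0 : S !=set0.
  apply/set0P/eqP => S0; apply: zS; exists 1; first exact: oner_neq0.
  by rewrite S0; exact: sub0set.
have [M M0 SM] : exists2 M : R, 0 < M &
    forall x, S x -> forall j, `|x ord0 j| <= M.
  have [M [Mr SM]] := compact_bounded cS.
  (* [compact_bounded] bounds the norm by every number strictly above [M]; the maximum with 1
     ensures positivity. *)
  exists (Num.max 1 (M + 1)); first by rewrite lt_max ltr01.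
  move=> x Sx j; apply: (@le_trans _ _ `|x|); last first.
    by apply: SM => //; rewrite lt_max ltrDl ltr01 orbT.
  rewrite [leRHS]/Num.norm /= mx_normrE.
  exact: (le_bigmax _ (fun i => `|x i.1 i.2|) (ord0, j)).
have [_ [K [_ K0 _ PhiK]]] := poly_lipschitz_bounded (Phi 1) SM.
have e0 k : 0 < harmonic k :> R by rewrite /= invr_gt0 ltr0n.
have /choice[Phi_ Phi_P] : forall k,
    exists Psi : {linear mpoly n R -> mpoly n R}, W S Psi /\
      forall p L, 0 <= L -> lipschitz_on S p L -> forall x, S x ->
        `|peval (Psi p - Phi p) x| <= L * harmonic k * K.
  move=> k.
  have [r [s [f [sS fS sf]]]] := polynomial_approximate_identity S0 M0 SM (e0 k).
  (* Composing with [Phi] keeps the nodes and replaces each [f i] by [Phi (f i)], again nonnegative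
     on [S]. *)
  exists (point_operator s (Phi \o f)); split.
    by exists r, s, (Phi \o f); split=> // i; exact/PhiS/fS.
  move=> p L L0 pL x Sx /=.
  have -> : point_operator s (Phi \o f) p = Phi (\sum_i peval p (s i) *: f i).
    by rewrite linear_sum; apply: eq_bigr => i _; rewrite linearZ.
  rewrite -linearB; apply: (nonneg_preserver_bound PhiS) Sx => //.
    by rewrite mulr_ge0 // ltW.
  by move=> z Sz; exact: sf.
exists Phi_; split=> [k|p]; first exact: (Phi_P k).1.
(* [L] depends on [p] but not on [k], so the bound tends to 0 with [harmonic k]. *)
have [L [_ [L0 _ pL _]]] := poly_lipschitz_bounded p SM.
apply: (@squeeze_cvgr _ _ _ _ (cst 0) (fun k => L * harmonic k * K)).
- by near=> k; apply: supnorm_le => // x Sx; exact: (Phi_P k).2.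
- exact: cvg_cst.
- rewrite -[X in _ --> X](mul0r K) -(mulr0 L).
  apply: cvgM; last exact: cvg_cst.
  by apply: cvgM; [exact: cvg_cst | exact: cvg_harmonic].
Unshelve. all: by end_near. Qed.
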